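(* Let $K$ be an algebraically closed field of arbitrary characteristic, let $n\ge 2$, and let $C=C(m_1,\dots,m_n)\subseteq\mathbb{P}^n$ be a recursive extension. For each $3\le i\le n$ let $a_i,b_i,c_i$ be non-negative integers with $$m_i=c_im_{i-1}+b_im_2+a_im_1,\qquad a_i<m_{i-1},\quad b_i<m_{i-1},\quad b_3=0,$$ and let $\alpha_i,\beta_i,\gamma_i$ be the associated non-negative integers (defined in the context), so that $$m_i=\gamma_im_{i-1}-\beta_im_2-\alpha_im_1,\qquad \alpha_i<m_{i-1},\quad \beta_i<m_{i-1},\quad \beta_3=0.$$ Suppose that $\gamma_i-\beta_i-\alpha_i-1\ge 0$ and $m_1\ge \beta_i(m_2-m_1)$ for all $3\le i\le n$. Put $F_1=x_1^{m_2}-x_2^{m_1}x_0^{m_2-m_1}$ and, for $3\le i\le n$, let $F_{i-1}=x_{i-1}^{m_i}+G_{i-1}+H_{i-1}$, where, with $N_i=m_{i-1}-m_1$, $$G_{i-1}=\sum_{k=1}^{N_i}(-1)^k\binom{m_{i-1}}{k}x_1^{k\alpha_i}x_2^{k\beta_i}x_{i-1}^{m_i-k\gamma_i}x_i^kx_0^{k(\gamma_i-\beta_i-\alpha_i-1)},$$ $$H_{i-1}=\sum_{k=N_i+1}^{m_{i-1}}(-1)^k\binom{m_{i-1}}{k}x_1^{a_i(m_{i-1}-k)}x_2^{b_i(m_{i-1}-k)}x_{i-1}^{c_i(m_{i-1}-k)}x_i^kx_0^{h_0(i,k)},$$ $$h_0(i,k)=k(a_i+b_i+c_i-1)-b_i(m_{i-1}-m_2)-a_i(m_{i-1}-m_1).$$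 Then $F_1,\dots,F_{n-1}$ are polynomials in $K[x_0,\dots,x_n]$ and $C$ is a set-theoretic complete intersection on $F_1,F_2,\dots,F_{n-1}$; that is, $C$ is exactly the set of common zeros in $\mathbb{P}^n$ of $F_1,\dots,F_{n-1}$.
   Context: For positive integers $m_1<\dots<m_n$ with $\gcd(m_1,\dots,m_n)=1$, the monomial curve $C(m_1,\dots,m_n)\subseteq\mathbb{P}^n$ over $K$ is the set of points $$(u^{m_n}:u^{m_n-m_1}v^{m_1}:\dots:u^{m_n-m_{n-1}}v^{m_{n-1}}:v^{m_n}),\qquad u,v\in K,\ (u,v)\ne(0,0),$$ with homogeneous coordinates $x_0,\dots,x_n$ on $\mathbb{P}^n$. It is called a recursive extension if, for every $3\le i\le n$, $m_i$ lies in the numerical semigroup $\langle m_1,\dots,m_{i-1}\rangle$, i.e. $m_i=a_{i,1}m_1+\dots+a_{i,i-1}m_{i-1}$ for some non-negative integers $a_{i,j}$. Given $a_i,b_i,c_i$, the associated integers $\alpha_i,\beta_i,\gamma_i$ are: $\alpha_i=0$ if $a_i=0$ and $\alpha_i=m_{i-1}-a_i$ if $a_i>0$; $\beta_i=0$ if $b_i=0$ and $\beta_i=m_{i-1}-b_i$ if $b_i>0$; and $\gamma_i=c_i$ if $a_i=b_i=0$, $\gamma_i=c_i+m_2$ if $a_i=0,\ b_i>0$, $\gamma_i=c_i+m_1$ if $a_i>0,\ b_i=0$, $\gamma_i=c_i+m_2+m_1$ if $a_i>0,\ b_i>0$. A curve in $\mathbb{P}^n$ is a set-theoretic complete intersection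 if it is the common zero set of $n-1$ homogeneous polynomials. *)

(* Defs.v *)
From mathcomp Require Import all_boot all_order all_algebra.
From mathcomp Require Export mpoly.

Set Implicit Arguments.
Unset Strict Implicit.
Unset Printing Implicit Defensive.

Import GRing.Theory Num.Theory.
Local Open Scope ring_scope.

(* Families indexed by 1..n or 3..n (m, a, b, c) are functions nat -> nat of
   which only the values at those indices matter. *)

(* A point of P^n is a line through the origin of K^(n+1); its homogeneous
   coordinates are the nonzero vectors of that line. *)
Definition projspace (K : fieldType) (n : nat) : Type :=
  {L : {vspace 'rV[K]_n.+1} | \dim L == 1%N}.

Definition vanishes (K : fieldType) (n : nat) (f : {mpoly K[n.+1]})
    (P : projspace K n) : Prop :=
  forall x : 'rV[K]_n.+1, x \in sval P -> x != 0 -> f.@[fun j => x 0 j] = 0.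

Definition stci_on (K : fieldType) (n : nat) (C : projspace K n -> Prop)
    (F : 'I_n.-1 -> {mpoly K[n.+1]}) : Prop :=
  (forall j, exists d, F j \is d.-homog) /\
  (forall P, C P <-> forall j, vanishes (F j) P).

Definition monomial_coords (K : fieldType) (n : nat) (m : nat -> nat)
    (u v : K) : 'rV[K]_n.+1 :=
  \row_(j < n.+1) if j == 0%N :> nat then u ^+ m n
                  else u ^+ (m n - m j) * v ^+ m j.

Definition monomial_curve (K : fieldType) (n : nat) (m : nat -> nat)
    (P : projspace K n) : Prop :=
  exists u v : K, (u, v) != (0, 0) /\ sval P = <[monomial_coords n m u v]>%VS.

Definition recursive_extension (n : nat) (m : nat -> nat) : Prop :=
  forall i, (3 <= i <= n)%N ->
    exists q : nat -> nat, m i = (\sum_(1 <= j < i) q j * m j)%N.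

Definition alpha (m a : nat -> nat) (i : nat) : int :=
  if a i == 0%N then 0 else (m i.-1)%:Z - (a i)%:Z.

Definition beta (m b : nat -> nat) (i : nat) : int :=
  if b i == 0%N then 0 else (m i.-1)%:Z - (b i)%:Z.

Definition gamma (m a b c : nat -> nat) (i : nat) : int :=
  if a i == 0%N then
    if b i == 0%N then (c i)%:Z else (c i)%:Z + (m 2%N)%:Z
  else
    if b i == 0%N then (c i)%:Z + (m 1%N)%:Z else (c i)%:Z + (m 2%N)%:Z + (m 1%N)%:Z.

Definition h0 (m a b c : nat -> nat) (i k : nat) : int :=
  k%:Z * ((a i)%:Z + (b i)%:Z + (c i)%:Z - 1)
  - (b i)%:Z * ((m i.-1)%:Z - (m 2%N)%:Z) - (a i)%:Z * ((m i.-1)%:Z - (m 1%N)%:Z).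

(* The expressions F_j carry integer exponents which are not visibly
   nonnegative, so they live in the field K(x_0, ..., x_n). *)
Definition ratfun_of (K : fieldType) (n : nat) (f : {mpoly K[n.+1]})
    : {fraction {mpoly K[n.+1]}} := FracField.tofrac f.

Definition xvar (K : fieldType) (n j : nat)
    : {fraction {mpoly K[n.+1]}} :=
  ratfun_of 'X_(inord j : 'I_n.+1).

(* G_(i-1) *)
Definition Gprev (K : fieldType) (n : nat) (m a b c : nat -> nat) (i : nat)
    : {fraction {mpoly K[n.+1]}} :=
  let x := xvar K n in
  let al := alpha m a i in
  let be := beta m b i in
  let ga := gamma m a b c i in
  \sum_(1 <= k < (m i.-1 - m 1%N).+1)
    (-1) ^+ k * ('C(m i.-1, k))%:R
    * x 1%N ^ (k%:Z * al) * x 2%N ^ (k%:Z * be)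
    * x i.-1 ^ ((m i)%:Z - k%:Z * ga)
    * x i ^+ k * x 0%N ^ (k%:Z * (ga - be - al - 1)).

(* H_(i-1) *)
Definition Hprev (K : fieldType) (n : nat) (m a b c : nat -> nat) (i : nat)
    : {fraction {mpoly K[n.+1]}} :=
  let x := xvar K n in
  \sum_((m i.-1 - m 1%N).+1 <= k < (m i.-1).+1)
    (-1) ^+ k * ('C(m i.-1, k))%:R
    * x 1%N ^+ (a i * (m i.-1 - k)) * x 2%N ^+ (b i * (m i.-1 - k))
    * x i.-1 ^+ (c i * (m i.-1 - k))
    * x i ^+ k * x 0%N ^ h0 m a b c i k.

(* F_j, for 1 <= j <= n - 1 *)
Definition Fexpr (K : fieldType) (n : nat) (m a b c : nat -> nat) (j : nat)
    : {fraction {mpoly K[n.+1]}} :=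
  let x := xvar K n in
  if j == 1%N then x 1%N ^+ m 2%N - x 2%N ^+ m 1%N * x 0%N ^+ (m 2%N - m 1%N)
  else x j ^+ m j.+1 + Gprev K n m a b c j.+1 + Hprev K n m a b c j.+1.

(* Main.v *)
Require Import Defs.
From mathcomp Require Import all_boot all_order all_algebra.
From mathcomp Require Import zify ring.
Import GRing.Theory Num.Theory.
Local Open Scope ring_scope.

(** Write p = m_(i-1) and q = m_i.  The polynomial F_(i-1) is a disguised
    binomial expansion: its k-th term is (-1)^k * 'C(p, k) times a monomial
    with x_i-exponent k, and giving x_0 weight 0 and x_j weight m_j for j < i
    makes the rest of this monomial of weight (p - k) * q.  So if x_0 = 1 and
    x_j = t^(m_j) for j = 1, 2, i-1, then F_(i-1) takes the value
    (t^q - x_i)^p ([step_eqn_affine]), and it vanishes exactly when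
    x_i = t^q.  In G_(i-1) the weight is distributed through
    q = gamma p - beta m_2 - alpha m_1, in H_(i-1) through
    q = c p + b m_2 + a m_1; the switch at k = p - m_1 is where the two
    inequalities assumed on alpha, beta and gamma make all exponents
    nonnegative ([gamma_nat_leq], [tail_exp_bound]).

    On the chart x_0 = 1, F_1 says x_1^(m_2) = x_2^(m_1).  By the
    recursion gcd(m_1, m_2) divides every m_i, so m_1 and m_2 are coprime
    ([coprime_of_recursion]) and x_1 = t^(m_1), x_2 = t^(m_2) for a single t
    ([common_root]).  The equations F_2, ..., F_(n-1) then give x_i = t^(m_i)
    one index after the other ([affine_zeros]): these are the points of the
    curve with u <> 0.

    On the hyperplane x_0 = 0, F_1 forces x_1 = 0.  Each term of F_(i-1) other
    than x_(i-1)^q contains x_0 or x_1, or else x_2 with i > 3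
    ([exponents_at_infinity]), so F_2, ..., F_(n-1) successively force
    x_2 = ... = x_(n-1) = 0 ([infinity_zeros]).  This leaves the point
    (0 : ... : 0 : 1), which is the point u = 0 of the curve.

    To evaluate the F_j in polynomials, in rational functions and in the field
    alike, they are written once over an arbitrary commutative ring, with
    exponents in nat ([curve_eqn]). *)

Set Implicit Arguments.
Unset Strict Implicit.
Unset Printing Implicit Defensive.

(** * Exponents as natural numbers *)

(** The absolute value of [alpha m a i]; with [b] in place of [a] it is that
    of [beta m b i]. *)
Definition alpha_nat (m a : nat -> nat) (i : nat) : nat :=
  if a i == 0%N then 0%N else (m i.-1 - a i)%N.

Definition gamma_nat (m a b c : nat -> nat) (i : nat) : nat :=
  (c i + (b i != 0%N) * m 2%N + (a i != 0%N) * m 1%N)%N.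

(** In the next three definitions the first branch is the exponent in the k-th
    term of G_(i-1) and the second the one in H_(i-1).  The term k = 0 falls
    under the first branch and is x_(i-1)^(m_i), so that F_(i-1) becomes a
    single sum over 0 <= k <= m_(i-1).

    The exponent of x_1; it is the exponent of x_2 when [b] replaces [a]. *)
Definition exp_x12 (m a : nat -> nat) (i k : nat) : nat :=
  if (k <= m i.-1 - m 1%N)%N then (k * alpha_nat m a i)%N
  else (a i * (m i.-1 - k))%N.

(** The exponent of x_(i-1). *)
Definition exp_xprev (m a b c : nat -> nat) (i k : nat) : nat :=
  if (k <= m i.-1 - m 1%N)%N then (m i - k * gamma_nat m a b c i)%N
  else (c i * (m i.-1 - k))%N.

(** The exponent of x_0. *)
Definition exp_x0 (m a b c : nat -> nat) (i k : nat) : nat :=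
  if (k <= m i.-1 - m 1%N)%N
  then (k * (gamma_nat m a b c i - alpha_nat m b i - alpha_nat m a i - 1))%N
  else (k * (a i + b i + c i - 1)
        - b i * (m i.-1 - m 2%N) - a i * (m i.-1 - m 1%N))%N.

(** The hypotheses on the index i, free of integer subtraction. *)
Record admissible (m a b c : nat -> nat) (i : nat) : Prop := Admissible {
  adm_m1_gt0 : (0 < m 1%N)%N;
  adm_m12 : (m 1%N < m 2%N)%N;
  adm_m2_le : (m 2%N <= m i.-1)%N;
  adm_lt : (m i.-1 < m i)%N;
  adm_eq : m i = (c i * m i.-1 + b i * m 2%N + a i * m 1%N)%N;
  adm_a : (a i < m i.-1)%N;
  adm_b : (b i < m i.-1)%N;
  adm_gamma : (alpha_nat m b i + alpha_nat m a i < gamma_nat m a b c i)%N;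
  adm_beta : (alpha_nat m b i * (m 2%N - m 1%N) <= m 1%N)%N;
  adm_b3 : i = 3%N -> b i = 0%N
}.

Lemma adm_sum_gt0 m a b c i : admissible m a b c i ->
  (0 < a i + b i + c i)%N.
Proof.
move=> A; have := adm_lt A; rewrite (adm_eq A).
by case: (a i) (b i) (c i) => [|?] [|?] [|?].
Qed.

Lemma gamma_nat_rel m a b c i : admissible m a b c i ->
  (gamma_nat m a b c i * m i.-1
   = m i + alpha_nat m b i * m 2%N + alpha_nat m a i * m 1%N)%N.
Proof.
case=> _ _ _ _ -> aP bP _ _ _; rewrite /gamma_nat /alpha_nat.
case: (eqVneq (a i) 0%N) => [->|_]; case: (eqVneq (b i) 0%N) => [->|_] /=; nia.
Qed.

(** After multiplication by m_(i-1), the worst case k = m_(i-1) - m_1 reads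
    beta m_2 + alpha m_1 <= m_1 gamma, and this follows from
    gamma >= beta + alpha + 1 and beta (m_2 - m_1) <= m_1. *)
Lemma gamma_nat_leq m a b c i k : admissible m a b c i ->
  (k <= m i.-1 - m 1%N)%N -> (k * gamma_nat m a b c i <= m i)%N.
Proof.
move=> A lek; have E := gamma_nat_rel A.
case: A => m1 m12 m2 _ _ _ _ G B _.
apply: leq_trans (leq_mul lek (leqnn _)) _.
rewrite mulnBl [(m i.-1 * _)%N]mulnC E leq_subLR.
move: (alpha_nat m b i) (alpha_nat m a i) (gamma_nat m a b c i) G B.
move=> be al ga G B.
have : (m 1%N * (be + al).+1 <= m 1%N * ga)%N by rewrite leq_mul2l G orbT.
move: B; rewrite mulnBr leq_subLR.
nia.
Qed.

(** This says h_0(i, k) >= 0.  As h_0 is nondecreasing in k, only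
    k = m_(i-1) - m_1 + 1 matters; there the inequality is clear if c_i > 0, and
    for c_i = 0 it comes from gamma_i - beta_i - alpha_i - 1 >= 0, by cases on
    whether a_i and b_i vanish. *)
Lemma tail_exp_bound m a b c i k : admissible m a b c i ->
  (m i.-1 - m 1%N < k)%N ->
  (b i * (m i.-1 - m 2%N) + a i * (m i.-1 - m 1%N)
   <= k * (a i + b i + c i - 1))%N.
Proof.
case=> m1 m12 m2 ltm eqm aP bP G B _ ltk.
apply: leq_trans (leq_mul ltk (leqnn _)).
move: ltm; rewrite eqm; move: G B {eqm ltk}; rewrite /gamma_nat /alpha_nat.
move: (a i) (b i) (c i) (m 1%N) (m 2%N) (m i.-1) aP bP m1 m12 m2.
move=> A B C M1 M2 P aP bP m1 m12 m2.
(* Additive coordinates m_2 = M1 + d and m_(i-1) = M1 + d + r remove the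
   truncated subtractions. *)
have [s eP] : exists s, P = (M1 + s)%N by exists (P - M1)%N; lia.
have [d eM2] : exists d, M2 = (M1 + d)%N by exists (M2 - M1)%N; lia.
have [r es] : exists r, s = (d + r)%N by exists (s - d)%N; lia.
subst P M2 s.
have -> : (M1 + (d + r) - (M1 + d) = r)%N by lia.
have -> : (M1 + (d + r) - M1 = d + r)%N by lia.
case: C => [|C].
  case: (eqVneq A 0%N) => [->|_]; case: (eqVneq B 0%N) => [->|_] /=; nia.
have -> : (A + B + C.+1 - 1 = A + B + C)%N by lia.
nia.
Qed.

(** F_(i-1) is homogeneous of degree m_i. *)
Lemma exponents_degree m a b c i k : admissible m a b c i ->
  (k <= m i.-1)%N ->
  (exp_x12 m a i k + exp_x12 m b i k + exp_xprev m a b c i k + k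
   + exp_x0 m a b c i k = m i)%N.
Proof.
move=> A lek; rewrite /exp_x12 /exp_xprev /exp_x0; case: leqP => [le|lt].
  have L := gamma_nat_leq A le; have G := adm_gamma A.
  move: (alpha_nat m b i) (alpha_nat m a i) (gamma_nat m a b c i) G L.
  move=> be al ga G L.
  have -> : (ga - be - al - 1 = ga - (be + al).+1)%N by lia.
  have [s es] : exists s, ga = ((be + al).+1 + s)%N
    by exists (ga - (be + al).+1)%N; lia.
  subst ga; rewrite addKn; move: L; rewrite !mulnDr !mulnS !mulnDr; lia.
have := tail_exp_bound A lt.
have pos := adm_sum_gt0 A.
case: A => m1 m12 m2 ltm eqm aP bP G B _.
rewrite [in RHS]eqm; move: pos {eqm ltm G B aP bP}.
move: (a i) (b i) (c i) => A B C pos bound.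
have [s es] : exists s, (A + B + C = s.+1)%N by exists (A + B + C).-1; lia.
move: bound; rewrite es subn1 /= => bound.
have : (k * s + k + (A + B + C) * (m i.-1 - k) = (A + B + C) * m i.-1)%N.
  have [t et] : exists t, m i.-1 = (k + t)%N by exists (m i.-1 - k)%N; lia.
  by rewrite es et addKn; ring.
have eB : (B * m i.-1 = B * m 2%N + B * (m i.-1 - m 2%N))%N.
  by rewrite -mulnDr subnKC.
have eA : (A * m i.-1 = A * m 1%N + A * (m i.-1 - m 1%N))%N.
  by rewrite -mulnDr subnKC // (leq_trans (ltnW m12)).
rewrite !mulnDl; move: bound eB eA; clear.
do ![move: (_ * _)%N | move=> ?]; lia.
Qed.

(** Along x_j = t^(m_j) the k-th monomial, without its x_i, is the power
    t^(m_i (m_(i-1) - k)) that occurs in the expansion of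
    (t^(m_i) - x_i)^(m_(i-1)). *)
Lemma exponents_weight m a b c i k : admissible m a b c i ->
  (k <= m i.-1)%N ->
  (m 1%N * exp_x12 m a i k + m 2%N * exp_x12 m b i k
   + m i.-1 * exp_xprev m a b c i k = m i * (m i.-1 - k))%N.
Proof.
move=> A lek; rewrite /exp_x12 /exp_xprev; case: leqP => [le|lt].
  have L := gamma_nat_leq A le; have E := gamma_nat_rel A.
  have e : (m i.-1 * (k * gamma_nat m a b c i)
            = m i * k + m 2%N * (k * alpha_nat m b i)
              + m 1%N * (k * alpha_nat m a i))%N.
    by rewrite mulnCA [(m i.-1 * _)%N]mulnC E; ring.
  have := leq_mul (leqnn (m i.-1)) L; rewrite !mulnBr e [(m i.-1 * _)%N]mulnC.
  by do ![move: (_ * _)%N | move=> ?]; lia.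
by rewrite [in RHS](adm_eq A); ring.
Qed.

(** If x_0, x_1 and x_2 were all absent, degree and weight would give
    e + k = m_i and m_(i-1) e = m_i (m_(i-1) - k) for the exponent e of
    x_(i-1), whence k m_(i-1) = k m_i, against m_(i-1) < m_i.  For i = 3 the
    variable x_2 is x_(i-1) itself, but then b_3 = 0 removes its separate
    factor. *)
Lemma exponents_at_infinity m a b c i k : admissible m a b c i ->
  (0 < k <= m i.-1)%N ->
  [|| 0 < exp_x0 m a b c i k, 0 < exp_x12 m a i k
    | (i != 3%N) && (0 < exp_x12 m b i k)]%N.
Proof.
move=> A /andP[k0 lek].
have i3 : (0 < exp_x12 m b i k)%N -> i != 3%N.
  apply: contraTneq => i3; have b0 := adm_b3 A i3.
  by rewrite /exp_x12 /alpha_nat b0 eqxx muln0 mul0n; case: ifP.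
suff : [|| 0 < exp_x0 m a b c i k, 0 < exp_x12 m a i k | 0 < exp_x12 m b i k]%N.
  by case/or3P=> [->//|->|h]; rewrite ?orbT // h i3 // !orbT.
apply: contraT; rewrite !negb_or -!leqNgt !leqn0.
case/and3P=> /eqP e0 /eqP e1 /eqP e2.
have := exponents_degree A lek.
have := exponents_weight A lek.
rewrite e0 e1 e2 !muln0 !addn0 !add0n; have [m1 _ _ ltm _ _ _ _ _ _] := A.
have [t et] : exists t, m i.-1 = (k + t)%N by exists (m i.-1 - k)%N; lia.
by move=> w d; move: w ltm; rewrite -d et addKn; nia.
Qed.

(** * The equations over a commutative ring *)

(** F_(i-1) evaluated at x. *)
Definition step_eqn (R : comNzRingType) (m a b c : nat -> nat) (x : nat -> R)
    (i : nat) : R :=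
  \sum_(k < (m i.-1).+1)
    (-1) ^+ k * ('C(m i.-1, k))%:R
    * x 1%N ^+ exp_x12 m a i k * x 2%N ^+ exp_x12 m b i k
    * x i.-1 ^+ exp_xprev m a b c i k * x i ^+ k * x 0%N ^+ exp_x0 m a b c i k.

(** F_j evaluated at x. *)
Definition curve_eqn (R : comNzRingType) (m a b c : nat -> nat) (x : nat -> R)
    (j : nat) : R :=
  if j == 1%N then x 1%N ^+ m 2%N - x 2%N ^+ m 1%N * x 0%N ^+ (m 2%N - m 1%N)
  else step_eqn m a b c x j.+1.

Lemma rmorph_curve_eqn (R S : comNzRingType) (f : {rmorphism R -> S})
    m a b c x j :
  f (curve_eqn m a b c x j) = curve_eqn m a b c (fun l => f (x l)) j.
Proof.
rewrite /curve_eqn; case: eqP => _.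
  by rewrite rmorphB rmorphM !rmorphXn.
rewrite /step_eqn rmorph_sum; apply: eq_bigr => k _.
by rewrite !rmorphM !rmorphXn rmorph_nat /= rmorphN rmorph1.
Qed.

Lemma alphaE m a i : (a i < m i.-1)%N -> alpha m a i = (alpha_nat m a i)%:Z.
Proof. by rewrite /alpha /alpha_nat => lt; case: eqP => // _; lia. Qed.

Lemma betaE m b i : (b i < m i.-1)%N -> beta m b i = (alpha_nat m b i)%:Z.
Proof. exact: alphaE. Qed.

Lemma gammaE m a b c i : gamma m a b c i = (gamma_nat m a b c i)%:Z.
Proof. by rewrite /gamma /gamma_nat; case: eqP; case: eqP => _ _ /=; lia. Qed.

(** All integer exponents in the rational expression are the natural exponents
    above, so the expression is a polynomial. *)
Lemma curve_eqn_xvar (K : fieldType) n m a b c j :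
  (j.+1 != 2%N -> admissible m a b c j.+1) ->
  curve_eqn m a b c (xvar K n) j = Fexpr K n m a b c j.
Proof.
rewrite /curve_eqn /Fexpr eqSS; case: eqP => //= _ /(_ isT) A.
have [_ m12 m2le _ _ aP bP G _ _] := A.
have m1le := leq_trans (ltnW m12) m2le.
rewrite /step_eqn -(big_mkord xpredT (fun k => (-1) ^+ k * ('C(m j, k))%:R
    * xvar K n 1%N ^+ exp_x12 m a j.+1 k * xvar K n 2%N ^+ exp_x12 m b j.+1 k
    * xvar K n j ^+ exp_xprev m a b c j.+1 k * xvar K n j.+1 ^+ k
    * xvar K n 0%N ^+ exp_x0 m a b c j.+1 k)) /=.
rewrite (@big_cat_nat _ _ _ (m j - m 1%N).+1) //=;
  last by rewrite ltnS leq_subr.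
congr (_ + _); last first.
  apply: eq_big_nat => k /andP[ltk _].
  rewrite /exp_x12 /exp_xprev /exp_x0 /= leqNgt ltk /=.
  suff -> : h0 m a b c j.+1 k = (k * (a j.+1 + b j.+1 + c j.+1 - 1)
        - b j.+1 * (m j - m 2%N) - a j.+1 * (m j - m 1%N))%N%:Z by [].
  have := tail_exp_bound A ltk.
  have pos := adm_sum_gt0 A.
  rewrite /h0 /= => bound.
  by rewrite -subnDA -(subzn bound) PoszD !PoszM -!subzn // !PoszD; ring.
rewrite big_ltn // big_add1 /=.
congr (_ + _).
  rewrite /exp_x12 /exp_xprev /exp_x0 /= !mul0n subn0 bin0 !expr0.
  by rewrite !mul1r !mulr1.
rewrite [RHS]big_add1 /=; apply: eq_big_nat => k /andP[_ ltk].
rewrite /exp_x12 /exp_xprev /exp_x0 /= ltk (alphaE aP) (betaE bP) gammaE.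
rewrite -!PoszM subzn ?(gamma_nat_leq A) //.
have -> : (gamma_nat m a b c j.+1)%:Z - (alpha_nat m b j.+1)%:Z
            - (alpha_nat m a j.+1)%:Z - 1
   = (gamma_nat m a b c j.+1 - alpha_nat m b j.+1
      - alpha_nat m a j.+1 - 1)%N%:Z by lia.
by rewrite -PoszM.
Qed.

Lemma step_eqn_affine (R : comNzRingType) m a b c (x : nat -> R) t i :
  admissible m a b c i ->
  x 0%N = 1 -> x 1%N = t ^+ m 1%N -> x 2%N = t ^+ m 2%N ->
  x i.-1 = t ^+ m i.-1 ->
  step_eqn m a b c x i = (t ^+ m i - x i) ^+ m i.-1.
Proof.
move=> A x0 x1 x2 xy; rewrite exprBn; apply: eq_bigr => k _.
have lek : (k <= m i.-1)%N by rewrite -ltnS.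
rewrite x0 x1 x2 xy expr1n mulr1 -!exprM.
rewrite -(exponents_weight A lek) !exprD -mulr_natl; ring.
Qed.

Lemma step_eqn_infinity (R : comNzRingType) m a b c (x : nat -> R) i :
  admissible m a b c i ->
  x 0%N = 0 -> x 1%N = 0 -> (i != 3%N -> x 2%N = 0) ->
  step_eqn m a b c x i = x i.-1 ^+ m i.
Proof.
move=> A x0 x1 x2; rewrite /step_eqn big_ord_recl big1 => [|k _] /=.
  rewrite /exp_x12 /exp_xprev /exp_x0 /= !mul0n subn0 bin0 !expr0.
  by rewrite !mul1r !mulr1 addr0.
have /or3P[p|p|/andP[i3 p]] := exponents_at_infinity (k := k.+1) A (ltn_ord k).
- by rewrite x0 [in X in _ * X]expr0n gtn_eqF // mulr0.
- by rewrite x1 expr0n gtn_eqF // mulr0 !mul0r.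
- by rewrite (x2 i3) [in X in _ * X * _ * _ * _]expr0n gtn_eqF // mulr0 !mul0r.
Qed.

(** * Homogeneity *)

Lemma curve_eqn_homog (K : fieldType) (n : nat) m a b c
    (x : nat -> {mpoly K[n]}) j :
  (m 1%N <= m 2%N)%N -> (j.+1 != 2%N -> admissible m a b c j.+1) ->
  (forall l, x l \is 1.-homog) ->
  curve_eqn m a b c x j \is (m j.+1).-homog.
Proof.
move=> m12; rewrite /curve_eqn eqSS => A hx.
have hX l e : x l ^+ e \is e.-homog by have := dhomogMn e (hx l); rewrite mul1n.
case: eqP A => [->_|_ /(_ isT) A].
  have := dhomogM (hX 2%N (m 1%N)) (hX 0%N (m 2%N - m 1%N)%N).
  by rewrite subnKC // => h; rewrite rpredB.
apply: rpred_sum => k _.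
have lek : (k <= m j)%N by rewrite -ltnS.
have hC : ((-1) ^+ k * ('C(m j, k))%:R : {mpoly K[n]}) \is 0.-homog.
  by rewrite rpredMsign -scaler_nat rpredZ ?dhomog1.
have := dhomogM (dhomogM (dhomogM (dhomogM (dhomogM hC
  (hX 1%N (exp_x12 m a j.+1 k))) (hX 2%N (exp_x12 m b j.+1 k)))
  (hX j (exp_xprev m a b c j.+1 k))) (hX j.+1 k))
  (hX 0%N (exp_x0 m a b c j.+1 k)).
by rewrite add0n (exponents_degree A lek).
Qed.

Lemma meval_scale (R : comNzRingType) n d (p : {mpoly R[n]}) (k : R) v :
  p \is d.-homog -> p.@[fun i => k * v i] = k ^+ d * p.@[v].
Proof.
move=> /dhomogP hp; rewrite !mevalE mulr_sumr !big_seq.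
apply: eq_bigr => mm /hp <-; rewrite mulrCA; congr (_ * _).
rewrite /= mdegE -prodrXr -big_split /=.
by apply: eq_bigr => i _; rewrite exprMn.
Qed.

(** * Zeros on the chart and at infinity *)

(** With u p - v q = 1, the solution is t = x^u / y^v. *)
Lemma common_root (K : fieldType) (p q : nat) (x y : K) :
  (0 < p)%N -> (0 < q)%N -> coprime p q -> x ^+ q = y ^+ p ->
  exists t, x = t ^+ p /\ y = t ^+ q.
Proof.
move=> p0 q0 /eqP cop e; have [x0|nx] := eqVneq x 0.
  exists 0; rewrite x0 !expr0n !gtn_eqF //; split=> //.
  by apply/eqP; have := expf_eq0 y p; rewrite p0 -e x0 expr0n gtn_eqF // eqxx.
have ny : y != 0.
  by apply: contraNneq (expf_neq0 q nx) => y0; rewrite e y0 expr0n gtn_eqF.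
have [u v uv _] := egcdnP q p0; rewrite cop in uv.
exists (x ^+ u / y ^+ v); rewrite !expr_div_n -!exprM; split.
  rewrite uv exprD expr1 [(v * p)%N]mulnC [(v * q)%N]mulnC !exprM e mulrAC.
  by rewrite divff ?mul1r // expf_neq0 // expf_neq0.
rewrite [(u * q)%N]mulnC exprM e -exprM [(p * u)%N]mulnC uv exprD expr1.
by rewrite mulrAC divff ?mul1r // expf_neq0.
Qed.

(** Once x_1 and x_2 are powers of one t, the equation F_(i-1) = 0 determines
    x_i: it says that a power of t^(m_i) - x_i is zero. *)
Lemma affine_zeros (K : fieldType) n m a b c (x : nat -> K) :
  (2 <= n)%N -> (0 < m 1 < m 2)%N -> coprime (m 1%N) (m 2%N) ->
  (forall i, (3 <= i <= n)%N -> admissible m a b c i) ->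
  x 0%N = 1 ->
  (forall j, (1 <= j < n)%N -> curve_eqn m a b c x j = 0) <->
  (exists t, forall j, (1 <= j <= n)%N -> x j = t ^+ m j).
Proof.
move=> n2 /andP[m1 m12] cop A x0.
split=> [F0|[t xt] j]; last first.
  have x1 := xt 1%N (ltnW n2); have x2 := xt 2%N n2.
  case: j => [|[|j]] // /andP[_ jn].
    by rewrite /curve_eqn /= x0 expr1n mulr1 x1 x2 -!exprM mulnC subrr.
  have Aj := A _ (jn : (3 <= j.+3 <= n)%N).
  rewrite /curve_eqn /= (step_eqn_affine Aj x0 x1 x2 (xt j.+2 (ltnW jn))).
  by rewrite (xt j.+3 jn) subrr expr0n gtn_eqF // (leq_ltn_trans _ (adm_a Aj)).
have := F0 1%N n2; rewrite /curve_eqn /= x0 expr1n mulr1.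
move/eqP; rewrite subr_eq0 => /eqP F1.
have [t [x1 x2]] := common_root m1 (ltn_trans m1 m12) cop F1.
exists t; elim=> [//|[|[|j]] // IH] jn.
have := F0 j.+2 jn; rewrite /curve_eqn /=.
rewrite (step_eqn_affine (A j.+3 jn) x0 x1 x2 (IH (ltnW jn))).
by move/eqP; rewrite expf_eq0 subr_eq0 => /andP[_ /eqP].
Qed.

(** On x_0 = 0 the equation F_j = 0 reduces to the vanishing of a power of x_j,
    as soon as the earlier coordinates are known to vanish. *)
Lemma infinity_zeros (K : fieldType) n m a b c (x : nat -> K) :
  (0 < m 1 < m 2)%N ->
  (forall i, (3 <= i <= n)%N -> admissible m a b c i) ->
  x 0%N = 0 ->
  (forall j, (1 <= j < n)%N -> curve_eqn m a b c x j = 0) <->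
  (forall j, (1 <= j < n)%N -> x j = 0).
Proof.
move=> /andP[m1 m12] A x0.
have F1 : curve_eqn m a b c x 1%N = x 1%N ^+ m 2%N.
  by rewrite /curve_eqn /= x0 expr0n gtn_eqF ?subn_gt0 // mulr0 subr0.
have m_gt0 j : (3 <= j <= n)%N -> m j != 0%N.
  by move=> /A /adm_lt; rewrite -lt0n; apply: leq_ltn_trans.
have FS j : (j.+2 < n)%N -> x 1%N = 0 -> (j != 0%N -> x 2%N = 0) ->
    curve_eqn m a b c x j.+2 = x j.+2 ^+ m j.+3.
  by move=> jn x1 x2; exact: step_eqn_infinity (A j.+3 jn) x0 x1 x2.
split=> [F0|xj] j; last first.
  case: j => [|[|j]] // jn.
    by rewrite F1 xj // expr0n gtn_eqF // (ltn_trans m1).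
  have x1 : x 1%N = 0 by rewrite xj // (ltn_trans _ jn).
  have x2 : j != 0%N -> x 2%N = 0.
    by move=> j0; rewrite xj // (ltn_trans _ jn) // !ltnS lt0n.
  by rewrite FS // xj // expr0n (negbTE (m_gt0 j.+3 jn)).
elim/ltn_ind: j => -[|[|j]] // IH jn.
  by have /eqP := F0 1%N jn; rewrite F1 expf_eq0 => /andP[_ /eqP].
have x1 : x 1%N = 0 by rewrite IH // (ltn_trans _ jn).
have x2 : j != 0%N -> x 2%N = 0.
  by move=> j0; rewrite IH // ?(ltn_trans _ jn) // !ltnS lt0n.
by have /eqP := F0 j.+2 jn; rewrite FS // expf_eq0 => /andP[_ /eqP].
Qed.

(** A common divisor of m_1 and m_2 divides every m_i by induction along the
    recursion, hence divides their gcd 1. *)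
Lemma coprime_of_recursion n m : (2 <= n)%N ->
  \big[gcdn/0%N]_(1 <= i < n.+1) m i = 1%N -> recursive_extension n m ->
  coprime (m 1%N) (m 2%N).
Proof.
move=> n2 g1 rec; rewrite /coprime; set d := gcdn _ _.
suff : (d %| 1)%N by rewrite dvdn1.
have dm i : (1 <= i <= n)%N -> (d %| m i)%N.
  elim/ltn_ind: i => -[|[|[|i]]] // IH; rewrite ?dvdn_gcdl ?dvdn_gcdr // => lei.
  have [q ->] := rec i.+3 lei; rewrite big_nat dvdn_sum // => j /andP[j1 ji].
  rewrite dvdn_mull // IH // j1 (leq_trans (ltnW ji)) //.
rewrite -g1 big_nat; elim/big_rec: _ => [|i x /dm di dx]; first exact: dvdn0.
by rewrite dvdn_gcd di.
Qed.

(** * Points of projective space *)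

(** Coordinates indexed by nat, as the exponent families are. *)
Definition coord (K : fieldType) (n : nat) (x : 'rV[K]_n.+1) (l : nat) : K :=
  x 0 (inord l).

Lemma coord_eq (K : fieldType) (n : nat) (x y : 'rV[K]_n.+1) :
  (forall l, (l <= n)%N -> coord x l = coord y l) -> x = y.
Proof.
move=> e; apply/rowP => i; have := e i; rewrite /coord inord_val; apply.
by rewrite -ltnS.
Qed.

Lemma coordZ (K : fieldType) (n : nat) k (x : 'rV[K]_n.+1) l :
  coord (k *: x) l = k * coord x l.
Proof. by rewrite /coord mxE. Qed.

Lemma coord_monomial (K : fieldType) n m (u v : K) l : (l <= n)%N ->
  coord (monomial_coords n m u v) l
  = if l == 0%N then u ^+ m n else u ^+ (m n - m l) * v ^+ m l.
Proof. by move=> ln; rewrite /coord mxE inordK. Qed.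

Definition curve_poly (K : fieldType) n m a b c (j : nat) : {mpoly K[n.+1]} :=
  curve_eqn m a b c (fun l => 'X_(inord l)) j.

Lemma meval_curve_poly (K : fieldType) n m a b c j (x : 'rV[K]_n.+1) :
  (curve_poly K n m a b c j).@[fun i => x 0 i] = curve_eqn m a b c (coord x) j.
Proof.
rewrite /curve_poly (rmorph_curve_eqn (meval (fun i => x 0 i))).
rewrite /curve_eqn /step_eqn.
case: ifP=> _; first by rewrite /= !mevalXU.
by apply: eq_bigr => k _; rewrite /= !mevalXU.
Qed.

Lemma line_point (K : fieldType) n (P : projspace K n) (x : 'rV[K]_n.+1) :
  x \in sval P -> x != 0 -> sval P = <[x]>%VS.
Proof.
case: P => L /= /eqP dL xL nx; apply/esym/eqP.
by rewrite eqEdim -memvE xL dL dim_vline nx.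
Qed.

Lemma point_coords (K : fieldType) n (P : projspace K n) :
  exists2 x, x \in sval P & x != 0.
Proof.
case: P => L /= dL; exists (vpick L); first exact: memv_pick.
by rewrite vpick0 -dimv_eq0 (eqP dL).
Qed.

(** Any spanning vector of the line P may serve as its coordinates.  Off the
    hyperplane x_0 = 0 it is normalised to x_0 = 1, and then the parameter of
    [affine_zeros] is t = v / u. *)
Lemma curve_zeros (K : fieldType) n m a b c (P : projspace K n) :
  (2 <= n)%N -> (0 < m 1 < m 2)%N -> coprime (m 1%N) (m 2%N) ->
  (forall i j, (1 <= i)%N -> (i < j)%N -> (j <= n)%N -> (m i < m j)%N) ->
  (forall i, (3 <= i <= n)%N -> admissible m a b c i) ->
  monomial_curve m P <->
  (forall j, (1 <= j < n)%N -> vanishes (curve_poly K n m a b c j) P).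
Proof.
move=> n2 m12 cop incr A.
have mn0 : m n != 0%N by have := incr 1%N n isT n2 (leqnn n); case: (m n).
have eqnH j : (1 <= j < n)%N -> curve_poly K n m a b c j \is (m j.+1).-homog.
  move=> jn; apply: curve_eqn_homog => [|j2|l];
    last by rewrite dhomogX /= mdeg1.
    by case/andP: m12 => _ /ltnW.
  by apply: A; move: jn j2; case: j => [|[|j]].
(* Homogeneity reduces vanishing on P to vanishing at one spanning vector. *)
have zerosP (w : 'rV[K]_n.+1) : w != 0 -> sval P = <[w]>%VS ->
    (forall j, (1 <= j < n)%N -> vanishes (curve_poly K n m a b c j) P) <->
    (forall j, (1 <= j < n)%N -> curve_eqn m a b c (coord w) j = 0).
  move=> nw Pw; split=> V j jn.
    by rewrite -meval_curve_poly; apply: (V j jn) => //; rewrite Pw memv_line.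
  move=> x; rewrite Pw => /vlineP[k ->] _.
  have := meval_scale k (fun i => w 0 i) (eqnH j jn).
  rewrite (meval_curve_poly m a b c j w) (V j jn) mulr0 => <-.
  by apply: meval_eq => i; rewrite mxE.
have le_m l : (0 < l <= n)%N -> (m l <= m n)%N.
  by case/andP=> l0; rewrite leq_eqVlt => /predU1P[->//|ln]; rewrite ltnW ?incr.
have [w wP nw] := point_coords P.
have Pw := line_point wP nw.
have [w0|w0] := eqVneq (coord w 0) 0.
  rewrite (zerosP w nw Pw) (infinity_zeros m12 A w0); split.
    case=> u [v [_ Pc]] j /andP[j0 jn].
    have := wP; rewrite Pc => /vlineP[k ew].
    have coordw l : (l <= n)%N ->
        coord w l = k * coord (monomial_coords n m u v) l.
      by move=> _; rewrite ew coordZ.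
    have k0 : k != 0 by apply: contraNneq nw => k0; rewrite ew k0 scale0r.
    have /eqP := coordw 0%N isT; rewrite coord_monomial //= w0 eq_sym mulf_eq0.
    rewrite (negbTE k0) expf_eq0 /= => /andP[_ /eqP u0].
    rewrite coordw 1?ltnW // coord_monomial 1?ltnW // gtn_eqF // u0 expr0n.
    by rewrite subn_eq0 leqNgt incr //= mul0r mulr0.
  move=> wj; exists 0, 1; split; first by rewrite xpair_eqE oner_eq0 andbF.
  have ew : w = coord w n *: monomial_coords n m 0 1.
    apply: coord_eq => l ln; rewrite coordZ coord_monomial // expr1n mulr1.
    case: eqP => [->|/eqP l0].
      by rewrite expr0n (negbTE mn0) mulr0.
    rewrite -lt0n in l0; move: ln; rewrite leq_eqVlt => /predU1P[->|ln].
      by rewrite subnn mulr1.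
    by rewrite wj ?l0 // expr0n subn_eq0 leqNgt incr // mulr0.
  have cn : coord w n != 0 by apply: contraNneq nw => e; rewrite ew e scale0r.
  apply: line_point.
    by rewrite -[monomial_coords _ _ _ _](scalerK cn) -ew memvZ.
  by apply: contraNneq nw => e; rewrite ew e scaler0.
pose z := (coord w 0)^-1 *: w.
have zP : z \in sval P by rewrite memvZ.
have nz : z != 0 by rewrite scaler_eq0 invr_eq0 negb_or w0.
have Pz := line_point zP nz.
have z0 : coord z 0 = 1 by rewrite coordZ mulVf.
rewrite (zerosP z nz Pz) (affine_zeros n2 m12 cop A z0); split.
  case=> u [v [_ Pc]].
  have := zP; rewrite Pc => /vlineP[k ez].
  have coordz l : (l <= n)%N ->
      coord z l = k * coord (monomial_coords n m u v) l.
    by move=> _; rewrite ez coordZ.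
  have := coordz 0%N isT; rewrite z0 coord_monomial //= => k1.
  have u0 : u != 0.
    apply: contra_eq_neq k1 => ->; rewrite expr0n (negbTE mn0) mulr0.
    exact: oner_neq0.
  exists (v / u) => j jn; case/andP: (jn) => j0 lej.
  rewrite coordz // coord_monomial // gtn_eqF // expr_div_n.
  apply: (mulIf (expf_neq0 (m j) u0)); rewrite mulfVK ?expf_neq0 //.
  rewrite -[RHS]mul1r k1 -[in RHS](subnK (le_m j jn)) exprD; ring.
case=> t zt; exists 1, t; split; first by rewrite xpair_eqE oner_eq0.
rewrite Pz; congr <[_]>%VS; apply: coord_eq => l ln.
rewrite coord_monomial // !expr1n mul1r; case: eqP => [->//|/eqP l0].
by rewrite zt // lt0n l0.
Qed.

Theorem theorem2p4 (K : closedFieldType) (n : nat) (m a b c : nat -> nat)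
  (hn : (2 <= n)%N)
  (m1_gt0 : (0 < m 1%N)%N)
  (m_incr : forall i j : nat, (1 <= i)%N -> (i < j)%N -> (j <= n)%N ->
     (m i < m j)%N)
  (m_gcd : \big[gcdn/0%N]_(1 <= i < n.+1) m i = 1%N)
  (m_rec : recursive_extension n m)
  (m_eq : forall i : nat, (3 <= i <= n)%N ->
     m i = (c i * m i.-1 + b i * m 2%N + a i * m 1%N)%N)
  (a_lt : forall i : nat, (3 <= i <= n)%N -> (a i < m i.-1)%N)
  (b_lt : forall i : nat, (3 <= i <= n)%N -> (b i < m i.-1)%N)
  (b3 : (3 <= n)%N -> b 3%N = 0%N)
  (hgamma : forall i : nat, (3 <= i <= n)%N ->
     0 <= gamma m a b c i - beta m b i - alpha m a i - 1)
  (hbeta : forall i : nat, (3 <= i <= n)%N ->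
     beta m b i * ((m 2%N)%:Z - (m 1%N)%:Z) <= (m 1%N)%:Z) :
  exists F : 'I_n.-1 -> {mpoly K[n.+1]},
    (forall j : 'I_n.-1, ratfun_of (F j) = Fexpr K n m a b c j.+1) /\
    stci_on (@monomial_curve K n m) F.
Proof.
have m12 : (m 1 < m 2)%N by apply: m_incr.
have A i : (3 <= i <= n)%N -> admissible m a b c i.
  move=> in3; have := hgamma i in3; have := hbeta i in3.
  have /andP[i3 lin] := in3; have aP := a_lt i in3; have bP := b_lt i in3.
  rewrite (alphaE aP) (betaE bP) gammaE => hb hg.
  split=> //; last 1 first.
  - by move=> ei; rewrite ei b3 // -ei.
  - move: i3 lin {hb hg aP bP in3}; case: i => [|[|[|[|i]]]] //= _ lin.
    by apply/ltnW/m_incr => //; apply: ltnW.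
  - by apply: m_incr; case: i i3 lin {hb hg aP bP in3} => [|[|[|i]]].
  - exact: m_eq.
  - by lia.
  - by move: hb; rewrite (subzn (ltnW m12)) -PoszM.
have admj j : (0 < j < n)%N -> j.+1 != 2%N -> admissible m a b c j.+1.
  by move=> /andP[j0 jn] j2; apply: A; case: j j0 jn j2 => [|[|j]].
have jP (j : 'I_n.-1) : (0 < j.+1 < n)%N.
  by rewrite -ltn_predRL ltn_ord.
exists (fun j => curve_poly K n m a b c j.+1); split=> [j|].
  rewrite /ratfun_of /curve_poly rmorph_curve_eqn.
  exact: curve_eqn_xvar (admj _ (jP j)).
split=> [j|P].
  exists (m j.+2); apply: curve_eqn_homog; [exact: ltnW|exact: admj|].
  by move=> l; rewrite dhomogX /= mdeg1.
have cop := coprime_of_recursion hn m_gcd m_rec.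
rewrite (curve_zeros P hn _ cop m_incr A) ?m1_gt0 //; split=> V j.
  exact: V.
move=> /andP[j0 jn].
have lj : (j.-1 < n.-1)%N by rewrite ltn_predRL prednK.
by have := V (Ordinal lj); rewrite /= prednK.
Qed.
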